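(* Suppose $k\ge 1$, $\sigma\in F_k(123)$, and $\sigma\ne k\cdots 21$ (the decreasing permutation). Then for all $n\ge 0$ we have $$|F_n(123,\sigma)|=\sum_{j=0}^{k-2}\binom{n-1}{j}.$$ The generating function for this sequence is $$\sum_{n=0}^\infty |F_n(123,\sigma)|x^n = 1+\frac{x(1-x)^{k-1}-x^k}{(1-2x)(1-x)^{k-1}}.$$
   Context: A permutation contains a pattern $\sigma$ if some subsequence of it has the same length and relative order as $\sigma$; otherwise it avoids $\sigma$. A Fishburn permutation is a permutation $\pi$ (in one-line notation) with no subsequence $\pi_j,\pi_{j+1},\pi_k$ such that $j+1<k$, $\pi_j=\pi_k+1$, and $\pi_{j+1}>\pi_j$. $F_n(\sigma_1,\dots,\sigma_m)$ is the set of Fishburn permutations of length $n$ avoiding each $\sigma_i$. Generating functions are formal power series. For $n=0$ the convention $\binom{-1}{0}=1$ and $\binom{-1}{j}=0$ for $j\ge1$ is used. *)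

(* Defs.v *)
From HB Require Import structures.
From mathcomp Require Import all_boot all_order all_algebra all_fingroup.
From mathcomp Require Import boolp.

Set Implicit Arguments.
Unset Strict Implicit.
Unset Printing Implicit Defensive.

Import GRing.Theory.
Local Open Scope ring_scope.

(* A permutation of length n is an element s of 'S_n; its one-line notation is
   s 0, s 1, ..., s (n - 1), that is, both positions and values are shifted
   down by one with respect to {1, ..., n}. *)

Section Fishburn.
Local Open Scope nat_scope.

Definition contains (n k : nat) (p : 'S_n) (s : 'S_k) : bool :=
  [exists f : {ffun 'I_k -> 'I_n},
    [forall i : 'I_k, forall j : 'I_k, (i < j) ==> (f i < f j)] &&
    [forall i : 'I_k, forall j : 'I_k, (p (f i) < p (f j)) == (s i < s j)]].

Definition avoids (n k : nat) (p : 'S_n) (s : 'S_k) : bool := ~~ contains p s.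

(* j' is the position j + 1. *)
Definition Fishburn (n : nat) (p : 'S_n) : bool :=
  ~~ [exists j : 'I_n, exists j' : 'I_n, exists k : 'I_n,
       [&& j' == j.+1 :> nat, j.+1 < k, p j == (p k).+1 :> nat & p j < p j']].

(* Patterns of arbitrary lengths are gathered in one list as tagged pairs. *)
Definition pattern : Type := {k : nat & 'S_k}.
Definition pat (k : nat) (s : 'S_k) : pattern := existT (fun k => 'S_k) k s.

Definition F (n : nat) (pats : seq pattern) : {set 'S_n} :=
  [set p : 'S_n | Fishburn p & all (fun q => avoids p (projT2 q)) pats].

Definition p123 : 'S_3 := 1%g.

Definition decreasing (k : nat) : 'S_k := perm (@rev_ord_inj k).

End Fishburn.

(* Formal power series over R, wrapped in a record because nat -> R already
   carries the pointwise ring structure. *)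
Record fps (R : Type) := Fps { fpscoef : nat -> R }.

Lemma fpsP (R : Type) (f g : fps R) : fpscoef f =1 fpscoef g -> f = g.
Proof. by case: f g => [f] [g] /= /funext ->. Qed.

HB.instance Definition _ (R : Type) := gen_eqMixin (fps R).
HB.instance Definition _ (R : Type) := gen_choiceMixin (fps R).

Section Zmodule.
Variable R : zmodType.
Implicit Types f g h : fps R.

Definition fps_zero : fps R := Fps (fun _ => 0).
Definition fps_opp f : fps R := Fps (fun n => - fpscoef f n).
Definition fps_add f g : fps R := Fps (fun n => fpscoef f n + fpscoef g n).

Lemma fps_addA : associative fps_add.
Proof. by move=> f g h; apply: fpsP => n /=; rewrite addrA. Qed.
Lemma fps_addC : commutative fps_add.
Proof. by move=> f g; apply: fpsP => n /=; rewrite addrC. Qed.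
Lemma fps_add0 : left_id fps_zero fps_add.
Proof. by move=> f; apply: fpsP => n /=; rewrite add0r. Qed.
Lemma fps_addN : left_inverse fps_zero fps_opp fps_add.
Proof. by move=> f; apply: fpsP => n /=; rewrite addNr. Qed.

HB.instance Definition _ :=
  GRing.isZmodule.Build (fps R) fps_addA fps_addC fps_add0 fps_addN.

End Zmodule.

Section Ring.
Variable R : comNzRingType.
Implicit Types f g h : fps R.

Definition fps_one : fps R := Fps (fun n => (n == 0)%:R).
Definition fps_mul f g : fps R :=
  Fps (fun n => \sum_(i < n.+1) fpscoef f i * fpscoef g (n - i)%N).

Definition fps_trunc N f : {poly R} := \poly_(i < N) fpscoef f i.

Lemma fps_mul_trunc N f g n : (n < N)%N ->
  fpscoef (fps_mul f g) n = (fps_trunc N f * fps_trunc N g)`_n.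
Proof.
move=> nN; rewrite coefM /=; apply: eq_bigr => i _.
rewrite !coef_poly (leq_ltn_trans (leq_subr i n) nN).
by rewrite (leq_ltn_trans _ nN) // -ltnS.
Qed.

Lemma fps_mulC : commutative fps_mul.
Proof. by move=> f g; apply: fpsP => n; rewrite !(@fps_mul_trunc n.+1) // mulrC. Qed.

Lemma fps_mulA : associative fps_mul.
Proof.
move=> f g h; apply: fpsP => n.
transitivity (fps_trunc n.+1 f * (fps_trunc n.+1 g * fps_trunc n.+1 h))`_n.
  rewrite coefM /=; apply: eq_bigr => i _; rewrite coef_poly ltn_ord.
  by rewrite -fps_mul_trunc // ltnS leq_subr.
rewrite mulrA coefM /=; apply: eq_bigr => i _.
by rewrite -fps_mul_trunc // coef_poly ltnS leq_subr.
Qed.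

Lemma fps_mul1 : left_id fps_one fps_mul.
Proof.
move=> f; apply: fpsP => n /=; rewrite big_ord_recl /= subn0 mul1r.
by rewrite big1 ?addr0 // => i _; rewrite mul0r.
Qed.

Lemma fps_mulDl : left_distributive fps_mul (@fps_add R).
Proof.
move=> f g h; apply: fpsP => n /=; rewrite -big_split /=.
by apply: eq_bigr => i _; rewrite mulrDl.
Qed.

Lemma fps_one_neq0 : fps_one != 0.
Proof.
apply/eqP => /(congr1 (fun f => fpscoef f 0)) /= /eqP.
by rewrite oner_eq0.
Qed.

HB.instance Definition _ := GRing.Zmodule_isComNzRing.Build (fps R)
  fps_mulA fps_mulC fps_mul1 fps_mulDl fps_one_neq0.

Definition fpsX : fps R := Fps (fun n => (n == 1)%:R).

Lemma fpscoef_one n : fpscoef (1 : fps R) n = (n == 0)%:R.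
Proof. by []. Qed.

Lemma fpscoef_mul f g n :
  fpscoef (f * g) n = \sum_(i < n.+1) fpscoef f i * fpscoef g (n - i)%N.
Proof. by []. Qed.

End Ring.

Section Inverse.
Variable R : comUnitRingType.
Implicit Types f g h : fps R.

Definition fps_unit : pred (fps R) :=
  fun f => fpscoef f 0 \is a GRing.unit.

(* The first n coefficients of the inverse of f: the coefficient g_m solves
   f_0 g_m + \sum_(i < m) f_(m - i) g_i = (m == 0). *)
Fixpoint fps_inv_seq f (n : nat) : seq R :=
  if n is m.+1 then
    let g := fps_inv_seq f m in
    rcons g ((fpscoef f 0)^-1 *
             ((m == 0)%:R - \sum_(i < m) g`_i * fpscoef f (m - i)%N))
  else [::].

(* As everywhere in the library, inversion is the identity on non-units. *)
Definition fps_inv f : fps R :=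
  if fps_unit f then Fps (fun n => (fps_inv_seq f n.+1)`_n) else f.

Lemma size_fps_inv_seq f n : size (fps_inv_seq f n) = n.
Proof. by elim: n => //= n IHn; rewrite size_rcons IHn. Qed.

Lemma fps_inv_seq_nth f n i : (i < n)%N ->
  (fps_inv_seq f n)`_i = (fps_inv_seq f i.+1)`_i.
Proof.
elim: n => // n IHn; rewrite ltnS leq_eqVlt => /predU1P[-> //|lt_in].
by rewrite [in LHS]/= nth_rcons size_fps_inv_seq lt_in IHn.
Qed.

Lemma fps_mulVr : {in fps_unit, left_inverse 1 fps_inv *%R}.
Proof.
move=> f uf; apply: fpsP => n.
have u0 : fpscoef f 0 \is a GRing.unit by [].
have invE i : fpscoef (fps_inv f) i = (fps_inv_seq f i.+1)`_i.
  by rewrite /fps_inv ifT.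
rewrite fpscoef_mul fpscoef_one big_ord_recr subnn /= invE /=.
rewrite nth_rcons size_fps_inv_seq ltnn eqxx mulrAC mulVr // mul1r.
set S := \sum_(i < n) _; set S' := \sum_(i < n) _.
suff -> : S = S' by rewrite addrC subrK.
by apply: eq_bigr => i _; rewrite invE -(@fps_inv_seq_nth f n i).
Qed.

Lemma fps_unitPl f g : g * f = 1 -> fps_unit f.
Proof.
move=> /(congr1 (fun h => fpscoef h 0)); rewrite fpscoef_mul big_ord1 subnn.
rewrite fpscoef_one eqxx => gf1.
by apply/unitrP; exists (fpscoef g 0); split; rewrite // mulrC.
Qed.

Lemma fps_inv_out : {in [predC fps_unit], fps_inv =1 id}.
Proof. by move=> f nuf; rewrite /fps_inv ifN. Qed.

HB.instance Definition _ := GRing.ComNzRing_hasMulInverse.Build (fps R)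
  fps_mulVr fps_unitPl fps_inv_out.

End Inverse.

(* Main.v *)
Require Import Defs.
From mathcomp Require Import all_boot all_order all_algebra all_fingroup.
From mathcomp Require Import zify ring.

(* In a Fishburn permutation avoiding 123 the bottom of every ascent is the
   least value: otherwise the value just below the bottom comes either before
   it, completing a 123, or after the ascent, completing the Fishburn pattern.
   So the one-line notation is D1 1 D2 with D1 and D2 decreasing, and it is
   coded by the binary word telling, for each value, whether it lies in D1 1 or
   in D2; every word whose first letter (that of the value 1) is true occurs.
   If sigma is not decreasing, it has a value in its second block; an occurrence
   of sigma therefore splits between the two blocks of p exactly as sigma does,
   and p contains sigma iff the word of sigma is a subsequence of the word of p.
   The number of binary words of length m avoiding u as a subsequence satisfies
   Pascal's recurrence, whatever u is. *)

(** * Permutations through comparisons of values *)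

Section FishburnWords.
Local Open Scope nat_scope.

Lemma card_ord_lt (n a : nat) : a <= n -> #|[set j : 'I_n | j < a]| = a.
Proof.
by move=> le_an; rewrite -sum1dep_card (big_ord_narrow le_an) sum1_card card_ord.
Qed.

(** A value is the number of smaller values, so the comparisons determine it. *)
Lemma perm_ord_inj (n : nat) (s t : 'S_n) :
  (forall i j : 'I_n, (s i < s j) = (t i < t j)) -> s = t.
Proof.
have rank (u : 'S_n) (i : 'I_n) : u i = #|[set j | u j < u i]| :> nat.
  rewrite -[LHS](@card_ord_lt n) ?(ltnW (ltn_ord _)) //.
  rewrite -(card_imset _ (@perm_inj _ u)); apply: eq_card => j.
  rewrite -(permKV u j) mem_imset ?inE //; exact: perm_inj.
move=> st; apply/permP => i; apply: val_inj; rewrite /= (rank s) (rank t).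
by apply: eq_card => j; rewrite !inE st.
Qed.

Lemma perm_ltnC (n : nat) (s : 'S_n) (i j : 'I_n) : i < j ->
  (s j < s i) = ~~ (s i < s j).
Proof.
move=> ij; case: (ltngtP (s i)) => // /val_inj /perm_inj eij.
by rewrite eij ltnn in ij.
Qed.

(** [s] is the standardization of [h]: it sends [i] to the number of keys below [h i]. *)
Lemma perm_of_key (n : nat) (h : 'I_n -> nat) : injective h ->
  exists s : 'S_n, forall i j, (s i < s j) = (h i < h j).
Proof.
move=> h_inj; pose r i := #|[set j | h j < h i]|.
have r_lt i j : h i < h j -> r i < r j.
  move=> hij; apply: proper_card; apply/properP; split.
    by apply/subsetP => x; rewrite !inE => /ltn_trans; apply.
  by exists i; rewrite !inE ?ltnn.
have rE i j : (r i < r j) = (h i < h j).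
  case: (ltngtP (h i) (h j)) => [/r_lt // | /r_lt /ltnW | /h_inj ->].
    by rewrite leqNgt => /negbTE.
  by rewrite ltnn.
have r_ord i : r i < n.
  rewrite -[X in _ < X]card_ord -cardsT; apply: proper_card.
  by apply/properP; split; [exact: subsetT | exists i; rewrite !inE ?ltnn].
have inj : injective (fun i => Ordinal (r_ord i)).
  move=> i j [rij]; apply: h_inj; apply/eqP; move: (rE i j) (rE j i).
  by rewrite rij ltnn; case: ltngtP.
by exists (perm inj) => i j; rewrite !permE /= rE.
Qed.

Lemma contains123P (n : nat) (p : 'S_n) :
  reflect (exists i j k : 'I_n, [/\ i < j, j < k, p i < p j & p j < p k])
    (contains p p123).
Proof.
apply: (iffP existsP) => [[f /andP[/'forall_'forall_implyP incf]] | ].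
  move=> /'forall_forallP ordf.
  pose x a := f (inord a : 'I_3).
  have lt a b : a < b < 3 -> x a < x b /\ p (x a) < p (x b).
    move=> ab; split; first by apply: incf; rewrite !inordK; lia.
    by rewrite (eqP (ordf _ _)) !perm1 !inordK; lia.
  exists (x 0), (x 1), (x 2).
  by have [//|? ?] := lt 0 1; have [//|? ?] := lt 1 2.
move=> [i [j [k [ij jk pij pjk]]]].
exists [ffun a : 'I_3 => nth i [:: i; j; k] a]; apply/andP; split.
  apply/'forall_'forall_implyP => -[[|[|[|//]]] ?] [[|[|[|//]]] ?] //= _;
  by rewrite !ffunE //=; lia.
apply/'forall_forallP => -[[|[|[|//]]] ?] [[|[|[|//]]] ?];
by rewrite !ffunE !perm1 /=; apply/eqP; lia.
Qed.

Lemma FishburnP (n : nat) (p : 'S_n) :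
  reflect (forall j j' k : 'I_n, j' = j.+1 :> nat -> j.+1 < k ->
             p j = (p k).+1 :> nat -> p j' <= p j)
    (Fishburn p).
Proof.
apply: (iffP negP) => [noF j j' k jj' jk pjk | noF].
  rewrite leqNgt; apply/negP => pjj'; apply: noF.
  by apply/existsP; exists j; apply/existsP; exists j'; apply/existsP; exists k;
     rewrite jj' eqxx jk pjk eqxx -pjk.
move=> /existsP[j /existsP[j' /existsP[k /and4P[/eqP jj' jk /eqP pjk]]]].
by rewrite ltnNge (noF j j' k).
Qed.

Lemma ascent_between (f : nat -> nat) (i j : nat) : i < j -> f i < f j ->
  exists2 a, i <= a < j & f a < f a.+1.
Proof.
elim: j => // j IHj; rewrite ltnS leq_eqVlt => /predU1P[<- ?|lt_ij lt_f].
  by exists i; rewrite ?leqnn.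
have [fj|fj] := ltnP (f j) (f j.+1); first by exists j; rewrite // ltnW /=.
have [|a /andP[ia aj] fa] := IHj lt_ij; first exact: leq_trans fj.
by exists a; rewrite // ia ltnW.
Qed.

(** * The binary word of a permutation *)

Context {m : nat}.
Implicit Types (p : 'S_m.+1) (t : m.+1.-tuple bool) (u v : 'I_m.+1).

Definition word p : m.+1.-tuple bool :=
  [tuple (p^-1)%g v <= (p^-1)%g ord0 | v < m.+1].

Lemma tnth_word p v : tnth (word p) v = ((p^-1)%g v <= (p^-1)%g ord0).
Proof. by rewrite tnth_mktuple. Qed.

Lemma word0 p : tnth (word p) ord0.
Proof. by rewrite tnth_word. Qed.

Lemma ascent_bottom p (a a' : 'I_m.+1) :
  Fishburn p -> avoids p p123 -> a' = a.+1 :> nat -> p a < p a' -> p a = ord0.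
Proof.
move=> /FishburnP fish /contains123P no123 aa' pa; apply: val_inj => /=.
apply/eqP; rewrite -leqn0 leqNgt; apply/negP => pa_gt0.
(* [c] is the position of the value just below [p a]. *)
pose c := (p^-1)%g (inord (p a).-1).
have pc : p a = (p c).+1 :> nat.
  by rewrite permKV inordK ?prednK // ltnW.
have [ca|ac|/val_inj ca] := ltngtP c a; last by move: pc; rewrite ca; lia.
  by apply: no123; exists c, a, a'; split=> //; lia.
(* [c] is not the top of the ascent, whose value is larger, so it lies beyond [a.+1]. *)
have ca' : c != a' by apply: contraTneq pa => <-; lia.
have ac' : a.+1 < c by move: ca'; rewrite -val_eqE /=; lia.
by have := fish a a' c aa' ac' pc; rewrite leqNgt pa.
Qed.

(** Both blocks are decreasing, so a smaller value precedes a larger one only across the blocks. *)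
Lemma mem_F123 p :
  reflect (forall u v, u < v ->
             ((p^-1)%g u < (p^-1)%g v) = tnth (word p) u && ~~ tnth (word p) v)
    (p \in F m.+1 [:: pat p123]).
Proof.
rewrite inE /= andbT.
apply: (iffP andP) => [[fish no123] u v uv | wordE].
  apply/idP/andP => [|[]]; rewrite !tnth_word -?ltnNge; last first.
    by move=> u0 /(leq_ltn_trans u0).
  move=> quv.
  (* Some ascent lies between the positions of [u] and [v]; its bottom is the least value, which
     separates them. *)
  have := @ascent_between (fun i => p (inord i)) _ _ quv.
  rewrite !inord_val !permKV => /(_ uv) [a /andP[ua av] pa].
  have am : a.+1 < m.+1 by apply: leq_ltn_trans av _.
  have ea := @ascent_bottom p (inord a) (inord a.+1) fish no123.
  have : p (inord a) = ord0 by apply: ea; rewrite // !inordK // ltnW.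
  move=> /(canRL (permK p)) <-; rewrite !inordK; lia.
have le_word v v' : (p^-1)%g v < (p^-1)%g v' -> v < v' ->
    tnth (word p) v /\ ~~ tnth (word p) v'.
  by move=> qvv' vv'; apply/andP; rewrite -wordE.
split.
  apply/FishburnP => j j' k jj' jk pjk; rewrite leqNgt; apply/negP => pjj'.
  (* The letters force [j] to be the position of the least value, but [p j] is a successor. *)
  have [|//|] := le_word (p j) (p j'); first by rewrite !permK; lia.
  rewrite !tnth_word !permK -ltnNge.
  have : j != (p^-1)%g ord0 by apply: contra_eq_neq pjk => ->; rewrite permKV.
  by rewrite -val_eqE /=; lia.
apply/negP => /contains123P[i [j [k [ij jk pij pjk]]]].
(* The middle value of a 123 would need both letters. *)
have [||_] := le_word (p i) (p j); rewrite ?permK //.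
by have [||->] := le_word (p j) (p k); rewrite ?permK.
Qed.

(** By [mem_F123] the word fixes the order of the positions of any two values. *)
Lemma word_inj : {in F m.+1 [:: pat p123] &, injective word}.
Proof.
move=> p q /mem_F123 pE /mem_F123 qE wpq.
apply: invg_inj; apply: perm_ord_inj => u v.
have lt_eq (x y : 'I_m.+1) : x < y ->
    ((p^-1)%g x < (p^-1)%g y) = ((q^-1)%g x < (q^-1)%g y).
  by move=> xy; rewrite pE // qE // wpq.
have [/lt_eq // | vu | /val_inj ->] := ltngtP u v; last by rewrite !ltnn.
by rewrite perm_ltnC // lt_eq // -perm_ltnC.
Qed.

Lemma word_surj t : tnth t ord0 ->
  exists2 p, p \in F m.+1 [:: pat p123] & word p = t.
Proof.
move=> t0.
(* Sorting the values by h puts those marked true first, and makes both groups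
   decreasing. *)
pose h v := if tnth t v then m - v else m.+1 + (m - v).
have h_inj : injective h.
  move=> u v; rewrite /h => huv; apply: val_inj => /=.
  by move: huv (ltn_ord u) (ltn_ord v); do 2 case: ifP => _; lia.
have [s sE] := perm_of_key _ _ h_inj.
(* The key of [ord0] is [m]: no key marked true exceeds it, and all the other keys do. *)
have wE : word (s^-1)%g = t.
  apply: eq_from_tnth => v; rewrite tnth_word invgK leqNgt sE /h t0.
  by case: (tnth t v) => /=; lia.
exists (s^-1)%g => //; apply/mem_F123 => u v uv; rewrite wE invgK sE /h.
by move: (ltn_ord v); case: (tnth t u) (tnth t v) => [] []; lia.
Qed.

End FishburnWords.

(** * Pattern containment as a subsequence relation on words *)

Section Counting.
Local Open Scope nat_scope.

Lemma sorted_enum_ord (m : nat) : sorted (fun i j : 'I_m => i < j) (enum 'I_m).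
Proof. by have := iota_ltn_sorted 0 m; rewrite -val_enum_ord sorted_map. Qed.

Lemma subseq_tupleP (T : eqType) (l m : nat) (a : l.-tuple T) (b : m.-tuple T) :
  reflect (exists2 g : 'I_l -> 'I_m, {homo g : i j / i < j} &
             forall i, tnth a i = tnth b (g i))
    (subseq a b).
Proof.
have ltO_trans : transitive (fun i j : 'I_m => i < j).
  by move=> j i k; apply: ltn_trans.
apply: (iffP idP) => [/subseqP[mk _ amk] | [g g_mono ag]].
  pose s := mask mk (enum 'I_m).
  have sb : map (tnth b) s = a by rewrite map_mask map_tnth_enum.
  have sz : size s == l by rewrite -(size_map (tnth b)) sb size_tuple.
  have ss : sorted (fun i j : 'I_m => i < j) s.
    by apply: sorted_mask => //; apply: sorted_enum_ord.
  exists (tnth (Tuple sz)) => [i j ij | i].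
    have x0 : 'I_m := tnth (Tuple sz) i.
    rewrite !(tnth_nth x0) /=.
    by apply: (sorted_ltn_nth ltO_trans x0 ss); rewrite // inE (eqP sz).
  have x0 : 'I_m := tnth (Tuple sz) i.
  by rewrite (tnth_nth (tnth b x0)) /= -sb (nth_map x0) ?(eqP sz) // (tnth_nth x0).
rewrite -(map_tnth_enum a) -(map_tnth_enum b) (eq_map ag) (map_comp (tnth b)).
apply: map_subseq.
(* Both lists are strictly sorted and have the same elements. *)
suff -> : map g (enum 'I_l) = [seq x <- enum 'I_m | x \in map g (enum 'I_l)].
  exact: filter_subseq.
apply: (irr_sorted_eq ltO_trans) => [i|||i].
- exact: ltnn.
- by rewrite sorted_map; apply: sub_sorted (sorted_enum_ord l) => i j /g_mono.
- by apply: sorted_filter => //; apply: sorted_enum_ord.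
- by rewrite mem_filter mem_enum andbT.
Qed.

(** Replacing the map of positions [f] by the map of values [p f s^-1] exchanges the two order
    conditions. Words are indexed by values, hence this form. *)
Lemma containsP (n k : nat) (p : 'S_n) (s : 'S_k) :
  reflect (exists2 g : 'I_k -> 'I_n, {homo g : i j / i < j} &
             forall i j, ((p^-1)%g (g i) < (p^-1)%g (g j)) =
                         ((s^-1)%g i < (s^-1)%g j))
    (contains p s).
Proof.
have mono (k' n' : nat) (f : 'I_k' -> 'I_n') : {homo f : i j / i < j} ->
    forall i j, (f i < f j) = (i < j).
  move=> inc i j; case: (ltngtP i j) => [/inc // | /inc | /val_inj ->].
    by case: ltngtP.
  by rewrite ltnn.
apply: (iffP existsP) => [[f /andP[/'forall_'forall_implyP incf]] | ].
  move=> /'forall_forallP ordf; exists (fun i => p (f ((s^-1)%g i))) => i j.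
    by move=> ij; rewrite (eqP (ordf _ _)) !permKV.
  by rewrite !permK (mono _ _ f) // => x y; apply: incf.
case=> g incg ordg; exists [ffun i => (p^-1)%g (g (s i))]; apply/andP; split.
  apply/'forall_'forall_implyP => i j ij.
  by rewrite !ffunE ordg !permK.
apply/'forall_forallP => i j; rewrite !ffunE !permKV; apply/eqP.
exact: (mono _ _ g).
Qed.

(** With no false letter the second block is empty. *)
Lemma word_decreasing (m : nat) (p : 'S_m.+1) :
  p \in F m.+1 [:: pat p123] -> (forall v, tnth (word p) v) ->
  p = decreasing m.+1.
Proof.
move=> /mem_F123 pE all1; apply: perm_ord_inj => i j.
have p_anti (x y : 'I_m.+1) : x < y -> p y < p x.
  move=> xy; rewrite ltnNge leq_eqVlt; apply/negP => /predU1P[|pxy].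
    by move=> /val_inj /perm_inj exy; rewrite exy ltnn in xy.
  by have := pE _ _ pxy; rewrite !permK xy !all1.
rewrite !permE /=; case: (ltngtP i j) => [ij|ji|/val_inj ->].
- by have := p_anti _ _ ij; lia.
- by rewrite p_anti //; have := ltn_ord i; lia.
- by rewrite !ltnn.
Qed.

(** A decreasing pattern may sit inside the second block: 132 contains 21, yet its word TFF has no
    subsequence TT. *)
Lemma contains_word (l m : nat) (p : 'S_m.+1) (s : 'S_l.+1) :
  p \in F m.+1 [:: pat p123] -> s \in F l.+1 [:: pat p123] ->
  s <> decreasing l.+1 ->
  contains p s = subseq (word s) (word p).
Proof.
move=> /mem_F123 pE sF s_dec; have /mem_F123 sE := sF.
have [v sv] : exists v, ~~ tnth (word s) v.
  apply/existsP; rewrite -negb_forall; apply/negP => /forallP all1.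
  exact/s_dec/word_decreasing.
have pos (u : 'I_l.+1) : u != ord0 -> 0 < u.
  by rewrite -val_eqE lt0n.
have v0 : 0 < v.
  by apply: pos; apply: contraNneq sv => ->; apply: word0.
apply/containsP/subseq_tupleP => [[g incg ordg] | [g incg sg]].
  (* [ord0] and [v] lie in different blocks of [s], so their images do in [p], which puts [g ord0]
     in the first block. *)
  have : (p^-1)%g (g ord0) < (p^-1)%g (g v) by rewrite ordg sE // word0.
  rewrite pE ?incg // => /andP[g0 gv].
  (* Comparison with [ord0], whose letter is now known on both sides, reveals every other letter. *)
  have gE a : a != ord0 -> tnth (word s) a = tnth (word p) (g a).
    move=> /pos a0; have := ordg ord0 a.
    by rewrite pE ?incg // sE // g0 word0 /= => /negb_inj ->.
  exists (fun a => if a == ord0 then ord0 else g a) => [a b ab | a].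
    have b0 : b != ord0 by rewrite -val_eqE /=; lia.
    rewrite (negbTE b0); case: eqP => [_|_]; last exact: incg.
    by apply: leq_ltn_trans (leq0n (g ord0)) _; apply: incg; apply: pos.
  by have [->|/gE //] := eqVneq a ord0; rewrite !word0.
(* Conversely, equal letters give equal orders of positions, by [mem_F123] on both sides. *)
exists g => // i j.
have lt_eq (x y : 'I_l.+1) : x < y ->
    ((p^-1)%g (g x) < (p^-1)%g (g y)) = ((s^-1)%g x < (s^-1)%g y).
  by move=> xy; rewrite pE ?incg // sE // !sg.
have [/lt_eq //|ji|/val_inj ->] := ltngtP i j; last by rewrite !ltnn.
by rewrite [LHS]perm_ltnC ?incg // [RHS]perm_ltnC // lt_eq.
Qed.

(** * Counting words and permutations *)

Lemma card_tuple_cons (m : nat) (P : pred (seq bool)) :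
  #|[set t : m.+1.-tuple bool | P t]| =
  #|[set t : m.-tuple bool | P (true :: t)]| +
  #|[set t : m.-tuple bool | P (false :: t)]|.
Proof.
rewrite -!sum1dep_card.
rewrite (reindex (fun x : bool * m.-tuple bool => cons_tuple x.1 x.2)) /=.
  rewrite -(pair_big_dep xpredT (fun b (t : m.-tuple bool) => P (b :: t))
             (fun _ _ => 1)) /=.
  by rewrite big_bool.
exists (fun t : m.+1.-tuple bool => (thead t, behead_tuple t)) => [[b t]|t] _ /=.
  by rewrite theadE; congr (_, _); apply: val_inj.
by apply: val_inj; exact: (esym (congr1 val (tuple_eta t))).
Qed.

(** After the first letter of [u] the rest must avoid the tail of [u]; after the other letter it
    must still avoid [u]. The two counts add up by Pascal's rule. *)
Lemma card_avoid_subseq (m : nat) (u : seq bool) :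
  #|[set t : m.-tuple bool | ~~ subseq u t]| = \sum_(0 <= j < size u) 'C(m, j).
Proof.
elim: m u => [|m IHm] [|a u].
- by rewrite big_geq //; apply: eq_card0 => t; rewrite inE /= sub0seq.
- rewrite big_nat_recl // big1 // -[RHS](card_tuple 0 bool) -cardsT.
  by apply: eq_card => t; rewrite !inE tuple0.
- by rewrite big_geq //; apply: eq_card0 => t; rewrite inE /= sub0seq.
rewrite (card_tuple_cons m (fun t => ~~ subseq (a :: u) t)) /=.
transitivity (\sum_(0 <= j < size u) 'C(m, j) +
              \sum_(0 <= j < (size u).+1) 'C(m, j)).
  rewrite -(IHm u) -(IHm (a :: u)).
  by case: a => //=; rewrite addnC.
rewrite [in LHS]big_nat_recl // [in RHS]big_nat_recl // !bin0 addnCA.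
by congr (_ + _); rewrite -big_split; apply: eq_bigr => j _; rewrite binS addnC.
Qed.

(** A word requires a least value, so length 0 is treated apart. *)
Lemma card_F_empty (k : nat) (s : 'S_k.+1) : #|F 0 [:: pat p123; pat s]| = 1.
Proof.
have no (l : nat) (p : 'S_0) (r : 'S_l.+1) : avoids p r.
  by apply/existsP => -[f _]; case: (f ord0).
rewrite -[RHS](card_Sn 0) -cardsT; apply: eq_card => p.
rewrite !inE /= !no !andbT; apply/FishburnP; case=> //.
Qed.

Lemma card_F (l n : nat) (s : 'S_l.+1) :
  s \in F l.+1 [:: pat p123] -> s <> decreasing l.+1 ->
  #|F n [:: pat p123; pat s]| = \sum_(0 <= j < l) 'C(n.-1, j).
Proof.
move=> sF s_dec.
have [a [u ws]] : exists a u, tval (word s) = a :: u.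
  by case/tupleP: (word s) => a u; exists a, u.
have a1 : a = true by have := word0 s; rewrite (tnth_nth false) ws.
have su : size u = l by have := size_tuple (word s); rewrite ws => -[].
case: n => [|m].
  (* The sum is 1 only if [l] is positive; for [l = 0] the only permutation is decreasing. *)
  rewrite card_F_empty; case: l s sF s_dec ws su => [s _ [] | l s _ _ _ _].
    by apply/permP => i; rewrite !ord1.
  by rewrite big_nat_recl // big1.
rewrite -[X in index_iota 0 X]su -(card_avoid_subseq m u).
pose W := [set p in F m.+1 [:: pat p123] | ~~ subseq (word s) (word p)].
have -> : F m.+1 [:: pat p123; pat s] = W.
  apply/setP => p; rewrite inE /= inE andbT andbA.
  have [pF|] := boolP (p \in F _ _).
    by move: (pF); rewrite inE /= andbT => -> ; rewrite /= /avoids contains_word.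
  by rewrite inE /= andbT => /negbTE ->.
transitivity #|word @: W|.
  rewrite card_in_imset // => p q; rewrite !inE => /andP[pF _] /andP[qF _].
  by apply: word_inj; rewrite inE.
pose P (t : seq bool) := head false t && ~~ subseq (true :: u) t.
transitivity #|[set t : m.+1.-tuple bool | P t]|.
  apply: eq_card => t; rewrite [RHS]inE /P -a1 -ws.
  have hd : head false t = tnth t ord0 by rewrite (tnth_nth false) nth0.
  apply/imsetP/andP => [[p] | [t0 st]].
    by rewrite inE => /andP[pF sp] tE; rewrite hd tE word0.
  have [|p pF pt] := word_surj t; first by rewrite -hd.
  by exists p => //; rewrite inE pF pt.
(* Words starting with false do not count; in the others the leading true cancels against that of
   [true :: u], leaving length [m]. *)
rewrite (card_tuple_cons m P) /=.
by rewrite [X in _ + X]eq_card0 ?addn0 // => t; rewrite inE.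
Qed.

End Counting.

Import GRing.Theory.

(** * Generating functions of binomial sums *)

Section GeneratingFunction.
Local Open Scope ring_scope.
Variable R : comNzRingType.

Lemma fpscoefD (f g : fps R) n : fpscoef (f + g) n = fpscoef f n + fpscoef g n.
Proof. by []. Qed.

Lemma fpscoefX0 (f : fps R) : fpscoef (fpsX R * f) 0 = 0.
Proof. by rewrite fpscoef_mul big_ord1 mul0r. Qed.

Lemma fpscoefXS (f : fps R) n : fpscoef (fpsX R * f) n.+1 = fpscoef f n.
Proof.
rewrite fpscoef_mul 2!big_ord_recl mul0r add0r mul1r subn1 big1 ?addr0 // => i _.
by rewrite mul0r.
Qed.

Definition bin_fps (j : nat) : fps R := Fps (fun n => 'C(n, j)%:R).

Definition bin_sum_fps (m : nat) : fps R :=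
  Fps (fun n => (\sum_(0 <= j < m) 'C(n, j))%:R).

Lemma bin_fps0 : (1 - fpsX R) * bin_fps 0 = 1.
Proof.
suff e : bin_fps 0 = 1 + fpsX R * bin_fps 0 by rewrite mulrBl mul1r {1}e addrK.
apply: fpsP => -[|n]; rewrite fpscoefD fpscoef_one ?fpscoefX0 ?fpscoefXS /= !bin0.
  by rewrite addr0.
by rewrite add0r.
Qed.

(** Pascal's rule, read on coefficients. *)
Lemma bin_fpsS j : (1 - fpsX R) * bin_fps j.+1 = fpsX R * bin_fps j.
Proof.
suff e : bin_fps j.+1 = fpsX R * bin_fps j + fpsX R * bin_fps j.+1.
  by rewrite mulrBl mul1r {1}e addrK.
apply: fpsP => -[|n]; rewrite fpscoefD ?fpscoefX0 ?fpscoefXS /= ?addr0 //.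
by rewrite binS natrD addrC.
Qed.

Lemma bin_fpsE j : (1 - fpsX R) ^+ j.+1 * bin_fps j = fpsX R ^+ j.
Proof.
elim: j => [|j IHj]; first by rewrite bin_fps0.
by rewrite exprSr -mulrA bin_fpsS mulrCA IHj exprS.
Qed.

(** Induction: multiply the identity for [m] by 1 - x and add (1 - 2x) x^m, the contribution of the
    new column. *)
Lemma bin_sum_fpsE m :
  (1 - 2%:R * fpsX R) * (1 - fpsX R) ^+ m * bin_sum_fps m =
  (1 - fpsX R) ^+ m - fpsX R ^+ m.
Proof.
elim: m => [|m IHm].
  rewrite subrr (_ : bin_sum_fps 0 = 0) ?mulr0 //.
  by apply: fpsP => n /=; rewrite big_geq.
have -> : bin_sum_fps m.+1 = bin_sum_fps m + bin_fps m.
  by apply: fpsP => n; rewrite fpscoefD /= big_nat_recr //= natrD.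
transitivity
  ((1 - fpsX R) * ((1 - 2%:R * fpsX R) * (1 - fpsX R) ^+ m * bin_sum_fps m) +
   (1 - 2%:R * fpsX R) * ((1 - fpsX R) ^+ m.+1 * bin_fps m)).
  by rewrite exprS; ring.
rewrite IHm bin_fpsE !exprS; ring.
Qed.

End GeneratingFunction.

(** The constant coefficient is 1. Taking [c] to be 1 and 2 covers both factors of the
    denominator. *)
Lemma unit_1BX (R : comUnitRingType) (c : fps R) :
  (1 - c * fpsX R)%R \is a GRing.unit.
Proof.
rewrite unfold_in /= /fps_unit.
rewrite -[(1 - _)%R]/(fps_add _ _) /= big_ord1 mulr0 oppr0 addr0.
exact: unitr1.
Qed.

Local Open Scope ring_scope.

(* 'C(n.-1, j) agrees with the convention for n = 0: 'C(0, j) is 1 if j = 0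
   and 0 otherwise. *)
Theorem proposition6p2 (k : nat) (sigma : 'S_k) :
  (1 <= k)%N ->
  sigma \in F k [:: pat p123] ->
  sigma <> decreasing k ->
  (forall n : nat,
     #|F n [:: pat p123; pat sigma]| = (\sum_(0 <= j < k.-1) 'C(n.-1, j))%N) /\
  Fps (fun n : nat => (#|F n [:: pat p123; pat sigma]|)%:R) =
    1 + (fpsX int * (1 - fpsX int) ^+ k.-1 - fpsX int ^+ k)
        / ((1 - 2%:R * fpsX int) * (1 - fpsX int) ^+ k.-1)
    :> fps int.
Proof.
case: k sigma => // l sigma _ sF s_dec.
have cF n := card_F l n sigma sF s_dec; split=> //=.
have u1 : 1 - fpsX int \is a GRing.unit by rewrite -[fpsX _]mul1r unit_1BX.
set D := _ * (1 - fpsX int) ^+ l.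
have uD : D \is a GRing.unit by rewrite unitrM unit_1BX unitrX.
(* The numerator is a multiple of [D], so the quotient is x times the series of binomial sums. *)
have -> : fpsX int * (1 - fpsX int) ^+ l - fpsX int ^+ l.+1 =
    fpsX int * bin_sum_fps int l * D.
  by rewrite exprS -mulrBr -bin_sum_fpsE -[RHS]mulrA [in RHS](mulrC _ D).
(* The summand 1 counts the empty permutation, and the factor x turns [n] into [n.-1] in the
   binomials. *)
rewrite mulrK //; apply: fpsP => -[|n]; rewrite fpscoefD fpscoef_one.
  by rewrite fpscoefX0 addr0 /= card_F_empty.
by rewrite fpscoefXS add0r /= cF.
Qed.
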